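(* Let $G$ be a group and let $R$ be a $G$-graded commutative ring. The following statements are equivalent: (1) $R$ is a Gelfand $G$-graded ring; (2) $G\mathrm{Max}(R)$ is a Zariski retract of $G\mathrm{Spec}(R)$, i.e. there exists a continuous map $\varphi: G\mathrm{Spec}(R)\to G\mathrm{Max}(R)$ such that $\varphi(M)=M$ for all $M\in G\mathrm{Max}(R)$.
   Context: $G$ is a group with identity $e$. A commutative ring $R$ with unit is $G$-graded if $R=\bigoplus_{g\in G}R_g$ with additive subgroups $R_g$ satisfying $R_gR_{g'}\subseteq R_{gg'}$; $h(R)=\bigcup_{g\in G}R_g$ is the set of homogeneous elements. An ideal $I$ is graded if $I=\bigoplus_{g\in G}(I\cap R_g)$. A homogeneous prime ideal is a graded ideal $P\neq R$ such that for all $r,s\in h(R)$, $rs\in P$ implies $r\in P$ or $s\in P$; $G\mathrm{Spec}(R)$ is the set of these. A graded maximal ideal is a graded ideal that is maximal among proper graded ideals; $G\mathrm{Max}(R)$ is the set of these (it is contained in $G\mathrm{Spec}(R)$). The Zariski topology on $G\mathrm{Spec}(R)$ has as closed sets the sets $V_G(I)=\{P\in G\mathrm{Spec}(R) : I\subseteq P\}$, $I$ a graded ideal; $G\mathrm{Max}(R)$ carries the subspace topology. $R$ is called a Gelfand ($G$-)graded ring if every homogeneous prime ideal of $R$ is contained in a unique graded maximal ideal of $R$. *)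

(* Defs.v *)
From HB Require Import structures.
From mathcomp Require Import all_boot all_order all_algebra.
From mathcomp Require Import all_classical.
From mathcomp Require Import topology.

Set Implicit Arguments.
Unset Strict Implicit.
Unset Printing Implicit Defensive.

Import GRing.Theory.

Local Open Scope classical_set_scope.
Local Open Scope ring_scope.

(* The elements of the external direct sum of the A g: families with finite
   support. Here A g is meant to be an additive subgroup of R. *)
Definition fsfamily (G : choiceType) (R : nmodType) (A : G -> set R) :
    set (G -> R) :=
  [set c | (forall g, A g (c g)) /\ finite_set [set g | c g != 0]].

(* S is the internal direct sum of the A g. *)
Definition is_direct_sum (G : choiceType) (R : nmodType)
    (S : set R) (A : G -> set R) : Prop :=
  set_bij (fsfamily A) S (fun c => \sum_(g \in [set: G]) c g).

Record grading (G : groupType) (R : comPzRingType) := Grading {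
  gpart :> G -> set R;
  gpart_zmod : forall g, zmod_closed [in gpart g];
  gpart_mul : forall g h x y,
    gpart g x -> gpart h y -> gpart (g * h)%g (x * y);
  gpart_dsum : is_direct_sum [set: R] gpart }.

Section GradedIdeals.
Variables (G : groupType) (R : comPzRingType) (gr : grading G R).

Definition homogeneous : set R := \bigcup_g gr g.

(* The whole ring is allowed. *)
Definition is_ideal (I : set R) : Prop :=
  zmod_closed [in I] /\ forall a x, I x -> I (a * x).

Definition graded_ideal (I : set R) : Prop :=
  is_ideal I /\ is_direct_sum I (fun g => I `&` gr g).

Definition hprime_ideal (P : set R) : Prop :=
  [/\ graded_ideal P, P <> [set: R] &
      forall r s, homogeneous r -> homogeneous s -> P (r * s) -> P r \/ P s].

Definition graded_maximal (M : set R) : Prop :=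
  [/\ graded_ideal M, M <> [set: R] &
      forall J, graded_ideal J -> J <> [set: R] -> M `<=` J -> J = M].

Definition gelfand : Prop :=
  forall P, hprime_ideal P -> exists! M, graded_maximal M /\ P `<=` M.

Definition GSpec := {P : set R | hprime_ideal P}.

HB.instance Definition _ := gen_eqMixin GSpec.
HB.instance Definition _ := gen_choiceMixin GSpec.

(* As a type, GMax carries the topology induced by that of GSpec. No graded
   maximal ideal is lost, see graded_maximal_hprime. *)
Definition GMax : set GSpec := [set M | graded_maximal (sval M)].

Definition zariski_V (I : set R) : set GSpec := [set P | I `<=` sval P].

Definition zariski_open (U : set GSpec) : Prop :=
  exists2 I, graded_ideal I & U = ~` zariski_V I.

Lemma zmod_closedP (S : set R) : zmod_closed [in S] <->
  [/\ S 0, forall x y, S x -> S y -> S (x + y) & forall x, S x -> S (- x)].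
Proof.
split=> [[S0 SB]|[S0 SD SN]].
  have P0 : S 0 by have := S0; rewrite !inE.
  have PB x y : S x -> S y -> S (x - y).
    by move=> Sx Sy; have := SB x y; rewrite !inE; apply.
  have PN x : S x -> S (- x) by move=> Sx; rewrite -[- x]add0r; apply: PB.
  by split=> // x y Sx Sy; rewrite -[y]opprK; apply: PB => //; apply: PN.
split; first by rewrite !inE.
by move=> x y; rewrite !inE => Sx Sy; apply: SD => //; apply: SN.
Qed.

Lemma graded_idealP (I : set R) : graded_ideal I <->
  is_ideal I /\ forall c, fsfamily gr c ->
    I (\sum_(g \in [set: G]) c g) -> forall g, I (c g).
Proof.
have [_ grinj grsurj] := gpart_dsum gr.
split=> [[idI [_ _ Isurj]]|[idI Ic]]; split=> //.
  move=> c fc Ic g; have [d [dI fd] dc] := Isurj _ Ic.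
  suff -> : c = d by case: (dI g).
  apply: grinj => //; rewrite inE //.
  by split=> // h; case: (dI h).
split.
- move=> c [cI _] /=; have [/zmod_closedP[I0 ID _] _] := idI.
  by apply: (big_ind I) => // g _; case: (cI g).
- move=> c d; rewrite !inE => -[cI fc] [dI fd]; apply: grinj; rewrite inE.
    by split=> // g; case: (cI g).
  by split=> // g; case: (dI g).
- move=> r Ir; have [c fc cr] := grsurj r Logic.I.
  exists c => //; split; last by case: fc.
  by move=> g; split; [apply: Ic; rewrite // cr|case: fc].
Qed.

Lemma is_idealT : is_ideal [set: R].
Proof. by split=> //; apply/zmod_closedP; split. Qed.

Lemma graded_idealT : graded_ideal [set: R].
Proof. by apply/graded_idealP; split=> //; exact: is_idealT. Qed.

Lemma graded_ideal_bigcap (T : Type) (D : set T) (F : T -> set R) :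
  (forall i, D i -> graded_ideal (F i)) -> graded_ideal (\bigcap_(i in D) F i).
Proof.
move=> gF; apply/graded_idealP; split; last first.
  move=> c fc Fc g i Di; have /graded_idealP[_ Fi] := gF _ Di.
  by apply: Fi => //; apply: Fc.
have zF i : D i -> _ := fun Di => (zmod_closedP (F i)).1 (gF i Di).1.1.
split; first (apply/zmod_closedP; split).
- by move=> i /zF[].
- by move=> x y Fx Fy i Di; have [_ FD _] := zF _ Di; apply: FD; auto.
- by move=> x Fx i Di; have [_ _ FN] := zF _ Di; apply: FN; auto.
- by move=> a x Fx i Di; apply: (gF i Di).1.2; auto.
Qed.

Lemma graded_idealI (I J : set R) :
  graded_ideal I -> graded_ideal J -> graded_ideal (I `&` J).
Proof.
move=> gI gJ; rewrite (_ : I `&` J = \bigcap_(b in [set: bool]) if b then I else J).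
  by apply: graded_ideal_bigcap => -[].
rewrite eqEsubset; split=> [x [Ix Jx] [] //|x IJx].
by split; [exact: (IJx true)|exact: (IJx false)].
Qed.

(* A graded ideal is generated by its homogeneous elements. *)
Lemma graded_ideal_subP (I P : set R) : graded_ideal I -> is_ideal P ->
  (forall x, homogeneous x -> I x -> P x) -> I `<=` P.
Proof.
move=> [_ [_ _ Isurj]] [/zmod_closedP[P0 PD _] _] IP x /Isurj[c [cI _] <-].
by apply: (big_ind P) => // g _; have [Ic grc] := cI g; apply: IP => //; exists g.
Qed.

Lemma zariski_VI (I J : set R) : graded_ideal I -> graded_ideal J ->
  zariski_V (I `&` J) = zariski_V I `|` zariski_V J.
Proof.
move=> gI gJ; rewrite eqEsubset; split=> [[P [gP PT Pp]] IJP|]; last first.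
  by move=> P [] sub x [? ?]; apply: sub.
apply: contrapT => nIJ; apply: (nIJ); left; apply: (graded_ideal_subP gI gP.1).
move=> x hx Ix; apply: contrapT => nPx.
apply: nIJ; right; apply: (graded_ideal_subP gJ gP.1) => y hy Jy.
have [] // : P x \/ P y.
apply: (Pp) => //; apply: IJP; split; last exact: gJ.1.2.
by rewrite mulrC; exact: gI.1.2.
Qed.

Lemma zariski_openT : zariski_open [set: GSpec].
Proof.
exists [set: R]; first exact: graded_idealT.
rewrite eqEsubset; split=> // -[P [gP PT Pp]] _ /= TP.
by apply: (PT); rewrite eqEsubset.
Qed.

Lemma zariski_openI : setI_closed zariski_open.
Proof.
move=> _ _ [I gI ->] [J gJ ->]; exists (I `&` J); first exact: graded_idealI.
by rewrite zariski_VI // setCU.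
Qed.

Lemma zariski_open_bigcup (T : Type) (f : T -> set GSpec) :
  (forall i, zariski_open (f i)) -> zariski_open (\bigcup_i f i).
Proof.
move=> of_; pose F i := s2val (cid2 (of_ i)).
have gF i : graded_ideal (F i) by rewrite /F; case: cid2.
have fF i : f i = ~` zariski_V (F i) by rewrite /F; case: cid2.
exists (\bigcap_(J in [set J | graded_ideal J /\ forall i, F i `<=` J]) J).
  by apply: graded_ideal_bigcap => J [].
rewrite -[LHS]setCK setC_bigcup; congr (~` _).
rewrite eqEsubset; split=> P PF.
  move=> x; apply; split; first by case: (svalP P).
  by move=> i; have := PF i Logic.I; rewrite fF setCK.
move=> i _; rewrite fF setCK => x Fx; apply: PF => J [_ FJ]; exact: (FJ i).
Qed.

HB.instance Definition _ := isOpenTopological.Build GSpec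
  zariski_openT zariski_openI zariski_open_bigcup.

Lemma zariski_openE : @open GSpec = zariski_open.
Proof. by []. Qed.

Lemma zariski_closedP (C : set GSpec) :
  closed C <-> exists2 I, graded_ideal I & C = zariski_V I.
Proof.
rewrite -openC zariski_openE; split=> -[I gI].
  by move=> /(congr1 setC); rewrite !setCK => ->; exists I.
by move=> ->; exists I.
Qed.

Lemma fsumrD (a b : G -> R) :
  finite_set [set g | a g != 0] -> finite_set [set g | b g != 0] ->
  \sum_(g \in [set: G]) (a g + b g) =
  \sum_(g \in [set: G]) a g + \sum_(g \in [set: G]) b g.
Proof.
move=> fa fb; pose U := [set g | a g != 0] `|` [set g | b g != 0].
have ab0 g : ~ U g -> a g = 0 /\ b g = 0.
  by move=> /not_orP[/negP/negPn/eqP-> /negP/negPn/eqP->].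
have widen (c : G -> R) : (forall g, ~ U g -> c g = 0) ->
    \sum_(g \in [set: G]) c g = \sum_(g \in U) c g.
  by move=> c0; apply/esym/fsbig_widen => // g [_ /c0].
rewrite !widen.
- by rewrite fsbig_split // finite_setU.
- by move=> g /ab0[].
- by move=> g /ab0[].
- by move=> g /ab0[-> ->]; rewrite addr0.
Qed.

Lemma graded_maximal_hprime (M : set R) : graded_maximal M -> hprime_ideal M.
Proof.
move=> [gM MT Mmax]; split=> // r s [k _ kr] [l _ ls] Mrs.
have [/graded_idealP[[zM Mmul] Mc] [M0 MD MN]] := (gM, (zmod_closedP M).1 gM.1.1).
apply: contrapT => /not_orP[nMr nMs].
pose J : set R := [set x | exists m t, M m /\ x = m + r * t].
have MJ : M `<=` J by move=> m Mm; exists m, 0; rewrite mulr0 addr0.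
have Jr : J r by exists 0, 1; rewrite mulr1 add0r.
have gJ : graded_ideal J.
  apply/graded_idealP; split.
    split; first (apply/zmod_closedP; split).
    - exact: MJ.
    - move=> _ _ [m [t [Mm ->]]] [m' [t' [Mm' ->]]]; exists (m + m'), (t + t').
      by split; [exact: MD|rewrite mulrDr addrACA].
    - move=> _ [m [t [Mm ->]]]; exists (- m), (- t).
      by split; [exact: MN|rewrite mulrN opprD].
    - move=> a _ [m [t [Mm ->]]]; exists (a * m), (a * t).
      by split; [exact: Mmul|rewrite mulrDr mulrCA].
  move=> c fc [m [t [Mm cE]]].
  have [_ grinj grsurj] := gpart_dsum gr.
  have [a fa am] := grsurj m Logic.I; have [b fb bt] := grsurj t Logic.I.
  have Ma : forall g, M (a g) by apply: Mc => //; rewrite am.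
  pose b' g := r * b (k^-1 * g)%g.
  have finb' : finite_set [set g | b' g != 0].
    apply: (@sub_finite_set _ _ ((fun g => (k * g)%g) @` [set g | b g != 0])).
      move=> g /= b'g; exists (k^-1 * g)%g; last by rewrite mulgA mulgV mul1g.
      by apply: contra_neq b'g => b0; rewrite /b' b0 mulr0.
    by apply: finite_image; case: fb.
  have bijk : bijective (fun g : G => (k^-1 * g)%g).
    by exists (fun g : G => (k * g)%g) => g; rewrite mulgA ?mulgV ?mulVg mul1g.
  have -> : c = (fun g => a g + b' g); last first.
    by move=> g; exists (a g), (b (k^-1 * g)%g).
  apply: grinj; rewrite ?inE //; last first.
    rewrite /= cE fsumrD //; last by case: fa.
    rewrite -am -bt; congr (_ + _).
    transitivity (r * \sum_(g \in [set: G]) b (k^-1 * g)%g).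
      by congr (_ * _); exact: reindex_fsbigT.
    rewrite full_fsbig_distrr // setTI.
    apply: (@sub_finite_set _ _ ((fun g => (k * g)%g) @` [set g | b g != 0])).
      move=> g /= /eqP bg; exists (k^-1 * g)%g => //.
      by rewrite mulgA mulgV mul1g.
    by apply: finite_image; case: fb.
  split.
    move=> g; have := gpart_zmod gr g => /zmod_closedP[_ grD _].
    apply: grD; first by case: fa.
    rewrite -[g in gr g](mul1g g) -(mulgV k) -mulgA.
    by apply: gpart_mul => //; case: fb.
  apply: (@sub_finite_set _ _ ([set g | a g != 0] `|` [set g | b' g != 0])).
    move=> g /=; have [->|] := eqVneq (a g) 0; last by left.
    by rewrite add0r; right.
  by rewrite finite_setU; split=> //; case: fa.
have JT : J = [set: R].
  by apply: contrapT => JT; apply: nMr; rewrite -(Mmax J).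
have [m [t [Mm e1]]] : J 1 by rewrite JT.
apply: nMs; rewrite -[s]mulr1 e1 mulrDr; apply: MD; first exact: Mmul.
by rewrite mulrA [s * r]mulrC [_ * t]mulrC; apply: Mmul.
Qed.

End GradedIdeals.

Arguments GMax {G R} gr _.
Arguments zariski_V {G R} gr I _.

(* Main.v *)
(* If phi is a retraction and P lies in a graded maximal ideal M, then M is in
   the closure of P, so M = phi M is in the closure of phi P, that is,
   M = phi P. Conversely, let phi P be the graded maximal ideal above P. For
   distinct graded maximal ideals M and N, no homogeneous prime lies below both,
   so 0 is in the multiplicative set of products of homogeneous elements outside
   M and outside N respectively: a * b = 0 with a outside M and b outside N.
   If I is not contained in M = phi P, then I plus the kernel of the homogeneous
   localization at M lies in no graded maximal ideal. Thus 1 = x + y with x in I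
   and a * y = 0 for a homogeneous a outside M, and the open set of the
   Q avoiding a is a neighborhood of P on which phi Q never contains I, because
   y is in Q. *)
Require Import Defs.
From HB Require Import structures.
From mathcomp Require Import all_boot all_order all_algebra.
From mathcomp Require Import all_classical.
From mathcomp Require Import topology.

Local Open Scope classical_set_scope.
Local Open Scope ring_scope.

Import GRing.Theory.

Set Implicit Arguments.
Unset Strict Implicit.
Unset Printing Implicit Defensive.

Section GelfandRetract.
Variables (G : groupType) (R : comPzRingType) (gr : grading G R).
Implicit Types (x y r : R) (I J P M S : set R).

(** * Homogeneous components of an element *)

Lemma ex_component x :
  exists2 c, fsfamily gr c & \sum_(g \in [set: G]) c g = x.
Proof. by have [_ _ grsurj] := gpart_dsum gr; exact: grsurj. Qed.

(** The decomposition is picked by choice; [component_sum] shows that it is the only one. *)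
Definition component x : G -> R := s2val (cid2 (ex_component x)).

Lemma component_fsfamily x : fsfamily gr (component x).
Proof. by rewrite /component; case: cid2. Qed.

Lemma sum_component x : \sum_(g \in [set: G]) component x g = x.
Proof. by rewrite /component; case: cid2. Qed.

Lemma component_sum (c : G -> R) : fsfamily gr c ->
  component (\sum_(g \in [set: G]) c g) = c.
Proof.
move=> fc; have [_ grinj _] := gpart_dsum gr.
apply: grinj; rewrite ?inE //; first exact: component_fsfamily.
exact: sum_component.
Qed.

Lemma gpart_closed g :
  [/\ gr g 0, forall x y, gr g x -> gr g y -> gr g (x + y) &
      forall x, gr g x -> gr g (- x)].
Proof. exact/zmod_closedP/gpart_zmod. Qed.

Lemma componentD x y g :
  component (x + y) g = component x g + component y g.
Proof.
have [grx fx] := component_fsfamily x; have [gry fy] := component_fsfamily y.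
rewrite -{1}[x]sum_component -{1}[y]sum_component -fsumrD // component_sum //.
split=> [h|]; first by have [_ grD _] := gpart_closed h; exact: grD.
apply: (@sub_finite_set _ _
  ([set g | component x g != 0] `|` [set g | component y g != 0])).
  move=> h /=; have [->|] := eqVneq (component x h) 0; last by left.
  by rewrite add0r; right.
by rewrite finite_setU.
Qed.

Lemma component0 g : component 0 g = 0.
Proof. by apply: (addrI (component 0 g)); rewrite -componentD !addr0. Qed.

(** Multiplying by [r] of degree [k] translates degrees on the left by [k], so the translated
    family, times [r], is the unique decomposition of [r * x]. *)
Lemma component_homoM k r x g : gr k r ->
  component (r * x) g = r * component x (k^-1 * g)%g.
Proof.
move=> kr; have [grx fx] := component_fsfamily x.
have bijk : bijective (fun g : G => (k^-1 * g)%g).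
  by exists (fun g : G => (k * g)%g) => h; rewrite mulgA ?mulgV ?mulVg mul1g.
have fk : finite_set [set h | component x (k^-1 * h)%g != 0].
  apply: (@sub_finite_set _ _
      ((fun g => (k * g)%g) @` [set g | component x g != 0])).
    by move=> h /= xh; exists (k^-1 * h)%g; rewrite // mulgA mulgV mul1g.
  exact: finite_image.
have <- : \sum_(h \in [set: G]) (r * component x (k^-1 * h)%g) = r * x.
  rewrite -[x in RHS]sum_component.
  transitivity (r * \sum_(h \in [set: G]) component x (k^-1 * h)%g).
    rewrite full_fsbig_distrr // setTI.
    by apply: sub_finite_set fk => h /= /eqP.
  by congr (_ * _); apply/esym; exact: reindex_fsbigT.
rewrite component_sum //; split=> [h|].
  by rewrite -[h in gr h]mul1g -(mulgV k) -mulgA; exact: gpart_mul.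
by apply: sub_finite_set fk => h /=; apply: contra_neq => ->; rewrite mulr0.
Qed.

(** * Graded ideals and their constructions *)

Lemma graded_ideal_componentP I : graded_ideal gr I <->
  is_ideal I /\ forall x, I x -> forall g, I (component x g).
Proof.
rewrite graded_idealP; split=> -[idI Ic]; split=> //.
  by move=> x Ix; apply: Ic; rewrite ?sum_component //; exact: component_fsfamily.
by move=> c fc Ic' g; rewrite -[c]component_sum //; exact: Ic.
Qed.

Lemma idealP I : is_ideal I <->
  [/\ I 0, forall x y, I x -> I y -> I (x + y) & forall a x, I x -> I (a * x)].
Proof.
split=> [[/zmod_closedP[I0 ID _] IM] //|[I0 ID IM]].
by split=> //; apply/zmod_closedP; split=> // x Ix; rewrite -mulN1r; exact: IM.
Qed.

(** Reduces gradedness to generation by homogeneous elements: the elements all of whose multiples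
    have their components in [I] form an ideal, which contains every homogeneous element of [I]. *)
Lemma graded_ideal_gen I : is_ideal I ->
  (forall J, is_ideal J -> (forall x, homogeneous gr x -> I x -> J x) ->
     I `<=` J) ->
  graded_ideal gr I.
Proof.
move=> idI Igen; apply/graded_ideal_componentP; split=> //.
have [I0 ID IM] := (idealP I).1 idI.
(* Quantifying over [a] makes [J] stable under multiplication by elements that need not be
   homogeneous. *)
pose J := [set x | forall a g, I (component (a * x) g)].
suff IJ : I `<=` J by move=> x /IJ Jx g; rewrite -[x]mul1r.
apply: Igen.
  apply/idealP; split.
  - by move=> a g; rewrite mulr0 component0.
  - by move=> x y Jx Jy a g; rewrite mulrDr componentD; exact: ID.
  - by move=> b x Jx a g; rewrite mulrA.
move=> x [k _ kx] Ix a g.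
by rewrite mulrC (component_homoM _ _ kx) mulrC; exact: IM.
Qed.

Lemma graded_ideal0 : graded_ideal gr [set 0].
Proof.
apply: graded_ideal_gen; last by move=> J /idealP[J0 _ _] _ _ ->.
apply/idealP; split=> //= [x y -> ->|a x ->]; first exact: addr0.
exact: mulr0.
Qed.

Definition ideal_add I J := [set z | exists x y, [/\ I x, J y & z = x + y]].

Definition principal r := [set z | exists t, z = r * t].

Definition colon I r := [set x | I (r * x)].

Lemma ideal_addl I J : is_ideal J -> I `<=` ideal_add I J.
Proof. by move=> /idealP[J0 _ _] x Ix; exists x, 0; rewrite addr0. Qed.

Lemma ideal_addr I J : is_ideal I -> J `<=` ideal_add I J.
Proof. by move=> /idealP[I0 _ _] x Jx; exists 0, x; rewrite add0r. Qed.

Lemma graded_ideal_add I J :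
  graded_ideal gr I -> graded_ideal gr J -> graded_ideal gr (ideal_add I J).
Proof.
move=> gI gJ; have [idI idJ] := (gI.1, gJ.1).
have [[I0 ID IM] [J0 JD JM]] := ((idealP I).1 idI, (idealP J).1 idJ).
apply: graded_ideal_gen; first (apply/idealP; split).
- exact: ideal_addl.
- move=> _ _ [x [y [Ix Jy ->]]] [x' [y' [Ix' Jy' ->]]].
  by exists (x + x'), (y + y'); split; [exact: ID|exact: JD|rewrite addrACA].
- move=> a _ [x [y [Ix Jy ->]]]; exists (a * x), (a * y).
  by split; [exact: IM|exact: JM|rewrite mulrDr].
move=> K idK IJK _ [x [y [Ix Jy ->]]]; have [_ KD _] := (idealP K).1 idK.
apply: KD.
  by apply: (graded_ideal_subP gI idK) Ix => z hz /(ideal_addl idJ); exact: IJK.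
by apply: (graded_ideal_subP gJ idK) Jy => z hz /(ideal_addr idI); exact: IJK.
Qed.

Lemma principal_id r : principal r r.
Proof. by exists 1; rewrite mulr1. Qed.

Lemma principal_sub r I : is_ideal I -> I r -> principal r `<=` I.
Proof. by move=> [_ IM] Ir _ [t ->]; rewrite mulrC; exact: IM. Qed.

Lemma graded_ideal_principal r :
  homogeneous gr r -> graded_ideal gr (principal r).
Proof.
move=> hr; apply: graded_ideal_gen; first (apply/idealP; split).
- by exists 0; rewrite mulr0.
- by move=> _ _ [t ->] [u ->]; exists (t + u); rewrite mulrDr.
- by move=> a _ [t ->]; exists (a * t); rewrite mulrCA.
- move=> K idK rK; apply: principal_sub => //; apply: rK => //.
  exact: principal_id.
Qed.

(** For [r] of degree [k], [r] times the component of [x] at [g] is the component of [r * x] at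
    [k * g]. *)
Lemma graded_ideal_colon I r :
  graded_ideal gr I -> homogeneous gr r -> graded_ideal gr (colon I r).
Proof.
move=> /graded_ideal_componentP[/idealP[I0 ID IM] Ic] [k _ kr].
apply/graded_ideal_componentP; split; first (apply/idealP; split).
- by rewrite /colon /= mulr0.
- by move=> x y Ix Iy; rewrite /colon /= mulrDr; exact: ID.
- by move=> a x Ix; rewrite /colon /= mulrCA; exact: IM.
move=> x Ix g; have := Ic _ Ix (k * g)%g.
by rewrite (component_homoM _ _ kr) mulgA mulVg mul1g.
Qed.

(** Serves both the unions of chains and [loc_kernel]; directedness puts two summands into a common
    member. *)
Lemma graded_ideal_directed (T : Type) (D : set T) (F : T -> set R) :
  D !=set0 -> (forall i, D i -> graded_ideal gr (F i)) ->
  (forall i j, D i -> D j -> exists2 k, D k & F i `|` F j `<=` F k) ->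
  graded_ideal gr (\bigcup_(i in D) F i).
Proof.
move=> [i0 Di0] gF dirF; have idF i (Di : D i) := (idealP _).1 (gF i Di).1.
apply: graded_ideal_gen; first (apply/idealP; split).
- by exists i0 => //; have [] := idF _ Di0.
- move=> x y [i Di Fx] [j Dj Fy]; have [k Dk Fk] := dirF _ _ Di Dj.
  exists k => //; have [_ FD _] := idF _ Dk.
  by apply: FD; apply: Fk; [left|right].
- by move=> a x [i Di Fx]; exists i => //; have [_ _ FM] := idF _ Di; exact: FM.
move=> K idK FK x [i Di]; apply: (graded_ideal_subP (gF _ Di) idK) => y hy Fy.
by apply: FK => //; exists i.
Qed.

(** * Zorn's lemma: graded maximal ideals and homogeneous primes *)

Lemma exists_maximal_disjoint I S : graded_ideal gr I -> I `&` S = set0 ->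
  exists P, [/\ graded_ideal gr P, I `<=` P, P `&` S = set0 &
    forall J, graded_ideal gr J -> J `&` S = set0 -> P `<=` J -> J = P].
Proof.
move=> gI IS0.
(* Joining [I] to the members keeps the union of the empty chain valid. *)
pose admissible A := graded_ideal gr (A `|` I) /\ (A `|` I) `&` S = set0.
have [F FP Ftot|A [[gA AS0] Amax]] := @Zorn_bigcup R admissible.
  pose D := [set X | X = I] `|` [set X `|` I | X in F].
  have DE : \bigcup_(X in F) X `|` I = \bigcup_(Y in D) Y.
    rewrite eqEsubset; split=> [x [[X FX Xx]|Ix]|x].
    - by exists (X `|` I); [right; exists X|left].
    - by exists I => //; left.
    - by move=> [_ [->|[X FX <-]]]; [right|case=> ?; [left; exists X|right]].
  have DP Y : D Y -> graded_ideal gr Y /\ Y `&` S = set0.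
    by move=> [->//|[X FX <-]]; exact: FP.
  rewrite /admissible DE; split; last first.
    by rewrite setI_bigcupl; apply: bigcup0 => Y /DP[].
  apply: graded_ideal_directed; first by exists I; left.
    by move=> Y /DP[].
  move=> Y Z [->|[X FX <-]] DZ.
    exists Z => // x []// Ix; case: DZ => [->//|[X _ <-]]; by right.
  case: DZ => [->|[X' FX' <-]].
    exists (X `|` I); first by right; exists X.
    by move=> x []//; right.
  have [XX'|X'X] := Ftot _ _ FX FX'.
    exists (X' `|` I); first by right; exists X'.
    by rewrite subUset; split=> //; exact: setSU.
  exists (X `|` I); first by right; exists X.
  by rewrite subUset; split=> //; exact: setSU.
exists (A `|` I); split=> // J gJ JS0 AJ.
rewrite eqEsubset; split=> // x Jx; apply: contrapT => nx.
have JI : J `|` I = J by apply/setUidPl => y Iy; apply: AJ; right.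
(* [J] contains [I], so it is itself admissible, and [x] makes its inclusion over [A] strict. *)
apply: (Amax J); last by rewrite /admissible JI.
split=> [y Ay|JA]; first by apply: AJ; left.
by apply: nx; left; exact: JA.
Qed.

Lemma is_ideal1 I : is_ideal I -> I 1 -> I = setT.
Proof.
move=> [_ IM] I1; rewrite eqEsubset; split=> // x _.
by rewrite -[x]mulr1; exact: IM.
Qed.

(** An ideal is proper exactly when it avoids 1, so graded maximal ideals are the graded ideals
    maximal among those disjoint from [[set 1]]. *)
Lemma sub_graded_maximal I : graded_ideal gr I -> I <> setT ->
  exists2 M, graded_maximal gr M & I `<=` M.
Proof.
move=> gI IT; have properE J : graded_ideal gr J ->
    J <> setT <-> J `&` [set 1] = set0.
  move=> gJ; split=> [JT|J10 JT].
    by rewrite -subset0 => x [Jx /= x1]; apply/JT/(is_ideal1 gJ.1); rewrite -x1.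
  by have : (set0 : set R) 1 by rewrite -J10 JT.
have [M [gM IM M10 Mmax]] := exists_maximal_disjoint gI ((properE I gI).1 IT).
exists M => //; split=> //; first exact/properE.
by move=> J gJ /(properE J gJ); exact: Mmax.
Qed.

(** A graded ideal [P] maximal among those avoiding a multiplicative set is prime: if homogeneous
    [r] and [s] are outside [P], then [P + (r)] and [P + (s)] meet [S], and multiplying the two
    elements found would put a point of [S] in [P] if [r * s] were in [P]. *)
Lemma exists_hprime_disjoint I S :
  graded_ideal gr I -> I `&` S = set0 -> S !=set0 ->
  (forall x y, S x -> S y -> S (x * y)) ->
  exists P, [/\ hprime_ideal gr P, I `<=` P & P `&` S = set0].
Proof.
move=> gI IS0 [s0 Ss0] SM.
have [P [gP IP PS0 Pmax]] := exists_maximal_disjoint gI IS0.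
have [_ PD PM] := (idealP P).1 gP.1; exists P; split=> //; split=> //.
  by move=> PT; have : (P `&` S) s0; [rewrite PT|rewrite PS0].
have meetS r : homogeneous gr r -> ~ P r ->
    exists p t, P p /\ S (p + r * t).
  move=> hr nPr; have gr_r := graded_ideal_principal hr.
  have [|] := pselect (ideal_add P (principal r) `&` S = set0).
    move=> /(Pmax _ (graded_ideal_add gP gr_r)) PE; exfalso; apply: nPr.
    rewrite -PE; first exact: (ideal_addr gP.1 (principal_id r)).
    exact: ideal_addl gr_r.1.
  move=> /eqP/set0P[_ [[p [_ [Pp [t ->] ->]]] Sp]].
  by exists p, t.
move=> r s hr hs Prs; apply: contrapT => /not_orP[nPr nPs].
have [p [t [Pp Spt]]] := meetS r hr nPr.
have [q [u [Pq Squ]]] := meetS s hs nPs.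
suff : (P `&` S) ((p + r * t) * (q + s * u)) by rewrite PS0.
split; last exact: SM.
rewrite mulrDr; apply: (PD); first exact: PM.
rewrite mulrDl; apply: PD; first by rewrite mulrC; exact: PM.
by rewrite mulrACA mulrC; exact: PM.
Qed.

(** * Homogeneous elements outside a prime: cancellation, separation, localization *)

Lemma homogeneousM r s :
  homogeneous gr r -> homogeneous gr s -> homogeneous gr (r * s).
Proof.
by move=> [k _ kr] [l _ ls]; exists (k * l)%g => //; exact: gpart_mul.
Qed.

Lemma hprime_idealM P r s : hprime_ideal gr P -> homogeneous gr r ->
  homogeneous gr s -> ~ P r -> ~ P s -> ~ P (r * s).
Proof. by move=> [_ _ Pp] hr hs nPr nPs /(Pp _ _ hr hs)[]. Qed.

(** Primality speaks of homogeneous factors only; [x] is arbitrary because [colon P r] is graded,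
    hence generated by its homogeneous elements. *)
Lemma hprime_ideal_cancel P r x : hprime_ideal gr P -> homogeneous gr r ->
  ~ P r -> P (r * x) -> P x.
Proof.
move=> [gP _ Pp] hr nPr.
apply: (graded_ideal_subP (graded_ideal_colon gP hr) gP.1) => y hy.
by move=> /(Pp _ _ hr hy)[].
Qed.

Lemma homogeneous_notin P : is_ideal P -> P <> setT ->
  exists2 r, homogeneous gr r & ~ P r.
Proof.
move=> idP PT; apply: contrapT => nr; apply: PT; rewrite eqEsubset; split=> //.
apply: (graded_ideal_subP (graded_idealT gr) idP) => x hx _.
by apply: contrapT => nPx; apply: nr; exists x.
Qed.

(** The alternatives are whether the multiplicative set [S] contains 0; if not, a homogeneous prime
    avoiding [S] lies below both. *)
Lemma hprime_sub2_or_separated P Q : hprime_ideal gr P -> hprime_ideal gr Q ->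
  (exists2 H, hprime_ideal gr H & H `<=` P `&` Q) \/
  exists a b, [/\ homogeneous gr a, homogeneous gr b, ~ P a, ~ Q b & a * b = 0].
Proof.
move=> hP hQ; have [gP PT _] := hP; have [gQ QT _] := hQ.
pose S := [set x | exists a b, [/\ homogeneous gr a, homogeneous gr b,
  ~ P a, ~ Q b & x = a * b]].
have [S0|nS0] := pselect (S 0).
  by right; have [a [b [? ? ? ? /esym]]] := S0; exists a, b.
left.
(* These witnesses make [S] nonempty, and complete an element known to be outside only one of the
   two primes to a product in [S]. *)
have [a0 ha0 nPa0] := homogeneous_notin gP.1 PT.
have [b0 hb0 nQb0] := homogeneous_notin gQ.1 QT.
have [||||H [hH _ HS0]] := @exists_hprime_disjoint [set 0] S.
- exact: graded_ideal0.
- by rewrite -subset0 => _ [-> /nS0].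
- by exists (a0 * b0), a0, b0.
- move=> _ _ [a [b [ha hb nPa nQb ->]]] [a' [b' [ha' hb' nPa' nQb' ->]]].
  exists (a * a'), (b * b'); split; last exact: mulrACA.
  + exact: homogeneousM.
  + exact: homogeneousM.
  + exact: hprime_idealM.
  + exact: hprime_idealM.
have [gH _ _] := hH; have [_ HM] := gH.1; exists H => //.
have HnS y : H y -> ~ S y.
  by move=> Hy Sy; have : (H `&` S) y by []; rewrite HS0.
rewrite subsetI; split.
  apply: (graded_ideal_subP gH gP.1) => x hx Hx; apply: contrapT => nPx.
  by apply: (HnS (x * b0)); [rewrite mulrC; exact: HM|exists x, b0].
apply: (graded_ideal_subP gH gQ.1) => x hx Hx; apply: contrapT => nQx.
by apply: (HnS (a0 * x)); [exact: HM|exists a0, x].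
Qed.

(* The kernel of the localization at the homogeneous elements outside [P]. *)
Definition loc_kernel P :=
  \bigcup_(a in [set a | homogeneous gr a /\ ~ P a]) colon [set 0] a.

(** The union is directed: the annihilators of [a] and [b] both lie in that of [a * b], which is
    outside [P] by primality. *)
Lemma graded_ideal_loc_kernel P :
  hprime_ideal gr P -> graded_ideal gr (loc_kernel P).
Proof.
move=> hP; have [gP PT _] := hP; apply: graded_ideal_directed.
- by have [a ha nPa] := homogeneous_notin gP.1 PT; exists a.
- by move=> a [ha _]; exact: graded_ideal_colon graded_ideal0 ha.
- move=> a b [ha nPa] [hb nPb]; exists (a * b).
    by split; [exact: homogeneousM|exact: hprime_idealM].
  move=> x [] /= xE; rewrite /colon /=; last by rewrite -mulrA xE mulr0.
  by rewrite mulrAC xE mul0r.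
Qed.

(** Stated for every proper ideal [N] above [Q], so that it applies to whichever ideal the
    retraction assigns to [Q]. *)
Lemma gelfand_open_nbhs P M I : gelfand gr -> hprime_ideal gr P ->
  graded_maximal gr M -> P `<=` M -> graded_ideal gr I -> ~ I `<=` M ->
  exists a, [/\ homogeneous gr a, ~ P a &
    forall Q N, hprime_ideal gr Q -> ~ Q a -> is_ideal N -> N <> setT ->
      Q `<=` N -> ~ I `<=` N].
Proof.
move=> gel hP mM PM gI nIM; have hM := graded_maximal_hprime mM.
have gO := graded_ideal_loc_kernel hM.
have gK := graded_ideal_add gI gO.
have [x [y [Ix [a [ha nMa] ay0] xy1]]] : ideal_add I (loc_kernel M) 1.
  suff -> : ideal_add I (loc_kernel M) = setT by [].
  apply: contrapT => KT; have [N mN KN] := sub_graded_maximal gK KT.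
  have IN : I `<=` N := subset_trans (ideal_addl gO.1) KN.
  have ON : loc_kernel M `<=` N := subset_trans (ideal_addr gI.1) KN.
  (* A common prime below forces [N = M], against [I] not being inside [M]; otherwise [b] is killed
     by [a] outside [M], so it lies in the kernel and hence in [N]. *)
  have [[H hH HMN]|[a [b [ha hb nMa nNb ab0]]]] :=
    hprime_sub2_or_separated hM (graded_maximal_hprime mN).
    have [L [_ Luniq]] := gel H hH; apply: nIM.
    rewrite -(Luniq M) ?(Luniq N) //; split=> // z /HMN[] //.
  by apply: nNb; apply: ON; exists a.
exists a; split=> //; first by move=> /PM.
(* If [I] were inside [N], then [x] would be in [N], and [a * y = 0] puts [y] in [Q], so 1 would be
   in [N]. *)
move=> Q N hQ nQa idN NT QN IN; apply/NT/is_ideal1 => //; rewrite xy1.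
have [_ ND _] := (idealP N).1 idN; apply: ND; first exact: IN.
apply/QN/(hprime_ideal_cancel hQ ha nQa); rewrite ay0.
by have [[/idealP[]]] := hQ.
Qed.

(** * Zariski-continuous retractions and the Gelfand property *)

Lemma open_setC_zariski_V I :
  graded_ideal gr I -> open (~` zariski_V gr I).
Proof. by move=> gI; rewrite zariski_openE; exists I. Qed.

Lemma gelfand_retract : gelfand gr ->
  exists phi : GSpec gr -> set_type (GMax gr),
    continuous phi /\ forall M : set_type (GMax gr), phi (set_val M) = M.
Proof.
move=> gel.
have exphi (P : GSpec gr) : exists M : set_type (GMax gr),
    sval P `<=` sval (set_val M).
  have [M [[mM PM] _]] := gel _ (svalP P).
  pose M' : GSpec gr := exist _ M (graded_maximal_hprime mM).
  have MM' : M' \in GMax gr by rewrite inE.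
  by exists (SigSub MM').
have [phi phiP] := choice exphi; exists phi; split; last first.
  (* [M] lies in its image, and both are graded maximal. *)
  move=> M; have mM : graded_maximal gr _ := set_valP M.
  have mphi : graded_maximal gr _ := set_valP (phi (set_val M)).
  apply: val_inj; apply: eq_sig_hprop => [? ? ?|];
    first exact: Prop_irrelevance.
  by case: mM mphi => _ _ Mmax [gphi phiT _]; exact: Mmax (phiP _).
(* The subspace topology is initial for the inclusion, so continuity is tested on the open sets of
   [GSpec]. *)
apply: continuous_comp_initial; apply/continuousP => _ [I gI ->].
rewrite openE => P /= nIphi; have mphi : graded_maximal gr _ := set_valP (phi P).
have [a [ha nPa aP]] :=
  gelfand_open_nbhs gel (svalP P) mphi (phiP P) gI nIphi.
have gra := graded_ideal_principal ha.
apply: (filterS _ (open_nbhs_nbhs (conj (open_setC_zariski_V gra) _))).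
  move=> Q nQa; have [gN NT _] : graded_maximal gr _ := set_valP (phi Q).
  apply: (aP _ _ (svalP Q)) gN.1 NT (phiP Q).
  by have [[idQ _] _ _] := svalP Q; move=> Qa; apply: nQa; exact: principal_sub.
by move=> /(_ a (principal_id a)).
Qed.

Lemma retract_gelfand (phi : GSpec gr -> set_type (GMax gr)) :
  continuous phi -> (forall M : set_type (GMax gr), phi (set_val M) = M) ->
  gelfand gr.
Proof.
move=> cphi phiK P hP; pose P' : GSpec gr := exist _ P hP.
have cvphi : continuous (set_val \o phi).
  by move=> Q; apply: continuous_comp; [exact: cphi|exact: initial_continuous].
(* Every graded maximal ideal above [P] is the image of [P], which gives uniqueness. *)
have uniq M : graded_maximal gr M -> P `<=` M -> sval (set_val (phi P')) = M.
  move=> mM PM; pose M0 : GSpec gr := exist _ M (graded_maximal_hprime mM).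
  have M0max : M0 \in GMax gr by rewrite inE.
  have phiM : set_val (phi M0) = M0 := congr1 set_val (phiK (SigSub M0max)).
  have [gphi phiT phimax] : graded_maximal gr _ := set_valP (phi P').
  have : closed ((set_val \o phi) @^-1` zariski_V gr (sval (set_val (phi P')))).
    apply: closed_comp; first by move=> Q _; exact: cvphi.
    by apply/zariski_closedP; exists (sval (set_val (phi P'))).
  move=> /zariski_closedP[I gI IE].
  have : zariski_V gr I P' by rewrite -IE.
  (* Closed sets are stable under enlarging the prime, so the preimage of the closed set contains
     [M0] along with [P']. *)
  move=> IP; have : zariski_V gr I M0 by move=> x /IP; exact: PM.
  rewrite -IE /zariski_V /= phiM /= => phiM'.
  by have [gM MT _] := mM; apply/esym; exact: phimax.
have [gP PT _] := hP; have [M mM PM] := sub_graded_maximal gP PT.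
exists M; split=> // N [mN PN].
by rewrite -(uniq M) // (uniq N).
Qed.

End GelfandRetract.

Theorem theorem2p6 (G : groupType) (R : comPzRingType) (gr : grading G R) :
  gelfand gr <->
  exists phi : GSpec gr -> set_type (GMax gr),
    continuous phi /\ forall M : set_type (GMax gr), phi (set_val M) = M.
Proof.
split=> [|[phi [cphi phiK]]]; first exact: gelfand_retract.
exact: retract_gelfand cphi phiK.
Qed.
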